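(* Let $d, N, r \ge 1$ be integers and let $\widetilde f = (\widetilde f_{i_1\ldots i_d})_{1\le i_1,\ldots,i_d\le N}$ be a real tensor of order $d$. Let $\widetilde\varepsilon_\Sigma$ be the global discrepancy functional and $\widetilde\varepsilon_{c,i}$ ($1\le c\le d$, $1\le i\le N$) the grid of $d\times N$ local discrepancy functionals on hyperplanes, all regarded as functions of the collection of canonical decomposition cores $Q = (Q^c_{\alpha,i})_{1\le c\le d,\,1\le \alpha\le r,\,1\le i\le N}\in\mathbb{R}^{d\times r\times N}$. If $Q$ is a set of cores for which the conditions $$\frac{\partial \widetilde\varepsilon_{c,i}}{\partial Q^c_{\alpha,i}}(Q) = 0\quad\text{for all } c\in\{1,\ldots,d\},\ i\in\{1,\ldots,N\},\ \alpha\in\{1,\ldots,r\}$$ are valid on the grid of $d\times N$ functionals $\widetilde\varepsilon_{c,i}$, then $Q$ determines the point of extremum of the global functional $\widetilde\varepsilon_\Sigma$ in the space of cores $Q^c_{\alpha,i}$, that is, in $\mathbb{R}^{d\times r\times N}$.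
   Context: The tensor $\widetilde f$ is approximated by a canonical decomposition of rank $r$ with cores (factor matrices) $Q^s(\alpha,i)=Q^s_{\alpha,i}\in\mathbb{R}$, where $s=1,\ldots,d$ is the direction, $\alpha=1,\ldots,r$ the layer, and $i=1,\ldots,N$ the node along the direction; the approximation is $f_{i_1\ldots i_d}=\sum_{\alpha=1}^r\prod_{s=1}^d Q^s(\alpha,i_s)$. Pointwise discrepancy: $\widetilde R_{i_1\ldots i_d}=\sum_{\alpha=1}^r\prod_{s=1}^d Q^s(\alpha,i_s)-\widetilde f_{i_1\ldots i_d}$. Global discrepancy functional: $\widetilde\varepsilon_\Sigma=\frac{1}{2N^d}\sum_{i_1,\ldots,i_d=1}^N \widetilde R_{i_1\ldots i_d}^2$. Local discrepancy functional on the hyperplane orthogonal to direction $c$ at node $i$: $\widetilde\varepsilon_{c,i}=\frac{1}{2N^{d-1}}\sum \widetilde R_{i_1\ldots i_d}^2$, where the sum runs over all multi-indices $(i_1,\ldots,i_d)\in\{1,\ldots,N\}^d$ with $i_c=i$ fixed. All partial derivatives are taken with respect to the core entries $Q^c_{\alpha,i}$ as independent real variables, all other core entries being held fixed.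
   Formalization: ''Point of extremum'' is read as stationary point (zero differential of the global functional on the space of cores); a local minimum or maximum can fail: for d=2, N=r=1, f=1, Q=0 all the conditions hold but the global functional (xy-1)^2/2 has a saddle. *)

(* Defs.v *)
From HB Require Import structures.
From mathcomp Require Import all_boot all_order all_algebra.
From mathcomp Require Import all_classical all_reals all_analysis.

Set Implicit Arguments.
Unset Strict Implicit.
Unset Printing Implicit Defensive.

Import Order.TTheory GRing.Theory Num.Theory.
Import numFieldNormedType.Exports.

Local Open Scope ring_scope.

Definition multi_index (d N : nat) := {ffun 'I_d -> 'I_N}.

(* The space R^(d x r x N) of collections of cores, as a normed space: row s is
   the flattening (mxvec) of the r x N matrix Q^s. *)
Notation cores R d r N := 'M[R]_(d, r * N).

Section Discrepancy.
Context {R : realType} {d r N : nat}.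
Implicit Types (ft : multi_index d N -> R) (Q : cores R d r N).

Definition core_entry Q (s : 'I_d) (a : 'I_r) (i : 'I_N) : R :=
  Q s (mxvec_index a i).

Definition canonical_decomposition Q (I : multi_index d N) : R :=
  \sum_(a < r) \prod_(s < d) core_entry Q s a (I s).

Definition discrepancy ft Q (I : multi_index d N) : R :=
  canonical_decomposition Q I - ft I.

Definition global_discrepancy ft Q : R :=
  (2 * N%:R ^+ d)^-1 * \sum_(I : multi_index d N) discrepancy ft Q I ^+ 2.

Definition local_discrepancy ft (c : 'I_d) (i : 'I_N) Q : R :=
  (2 * N%:R ^+ d.-1)^-1 *
  \sum_(I : multi_index d N | I c == i) discrepancy ft Q I ^+ 2.

(* The partial derivative with respect to the entry Q^c_(a, i) is the
   derivative along the corresponding unit vector of the space of cores. *)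
Definition core_partial (F : cores R d r N -> R)
    (c : 'I_d) (a : 'I_r) (i : 'I_N) Q : R :=
  'D_(delta_mx c (mxvec_index a i)) F Q.

(* "Point of extremum" in the sense of the first-order condition: a stationary
   point in the whole space of cores. The differential is total; the condition
   does not assert a local minimum or maximum, which can fail: for d = 2,
   r = N = 1, ft = 1 the point Q = 0 is a saddle point of (x * y - 1) ^+ 2 / 2
   although every partial derivative of every functional vanishes there. *)
Definition stationary_point (F : cores R d r N -> R) Q : Prop :=
  differentiable F Q /\ forall H : cores R d r N, 'd F Q H = 0.

End Discrepancy.

(* Main.v *)
(* The entry Q^c_(a, i) enters the discrepancy at I only when I_c = i, so the
   partial derivatives of the global functional and of the local functional on
   the hyperplane I_c = i with respect to this entry agree up to the factor
   1/N.  The global functional is a polynomial, hence differentiable, and its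
   differential is determined by its partial derivatives. *)
Require Import Defs.
From HB Require Import structures.
From mathcomp Require Import all_boot all_order all_algebra.
From mathcomp Require Import all_classical all_reals all_analysis.

Set Implicit Arguments.
Unset Strict Implicit.
Unset Printing Implicit Defensive.

Import Order.TTheory GRing.Theory Num.Theory.
Import numFieldNormedType.Exports.

Local Open Scope ring_scope.

Lemma differentiable_fsum (R : realType) (V : normedModType R) (T : Type)
    (s : seq T) (P : pred T) (f : T -> V -> R) (x : V) :
  (forall t, P t -> differentiable (f t) x) ->
  differentiable (fun y => \sum_(t <- s | P t) f t y) x.
Proof.
move=> df; elim: s => [|t s IHs].
  rewrite (_ : (fun _ => _) = cst 0); first exact: differentiable_cst.
  by apply: funext => y; rewrite big_nil.
have [Pt|Pt] := boolP (P t); last first.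
  rewrite (_ : (fun _ => _) = fun y => \sum_(t <- s | P t) f t y) //.
  by apply: funext => y; rewrite big_cons (negbTE Pt).
rewrite (_ : (fun _ => _) = f t + (fun y => \sum_(t <- s | P t) f t y)).
  by apply: differentiableD => //; exact: df.
by apply: funext => y; rewrite big_cons Pt.
Qed.

Lemma differentiable_fprod (R : realType) (V : normedModType R) (T : Type)
    (s : seq T) (P : pred T) (f : T -> V -> R) (x : V) :
  (forall t, P t -> differentiable (f t) x) ->
  differentiable (fun y => \prod_(t <- s | P t) f t y) x.
Proof.
move=> df; elim: s => [|t s IHs].
  rewrite (_ : (fun _ => _) = cst 1); first exact: differentiable_cst.
  by apply: funext => y; rewrite big_nil.
have [Pt|Pt] := boolP (P t); last first.
  rewrite (_ : (fun _ => _) = fun y => \prod_(t <- s | P t) f t y) //.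
  by apply: funext => y; rewrite big_cons (negbTE Pt).
rewrite (_ : (fun _ => _) = f t * (fun y => \prod_(t <- s | P t) f t y)).
  by apply: differentiableM => //; exact: df.
by apply: funext => y; rewrite big_cons Pt.
Qed.

(** The differential is linear, the matrices [delta_mx i j] span the space, and for a differentiable
    [F] the value of ['d F A] on each of them is the directional derivative. *)
Lemma diff_matrix_eq0 (R : realType) (m n : nat) (F : 'M[R]_(m, n) -> R)
    (A : 'M[R]_(m, n)) :
  differentiable F A -> (forall i j, 'D_(delta_mx i j) F A = 0) ->
  forall H, 'd F A H = 0.
Proof.
move=> dF DF0 H; rewrite [H]matrix_sum_delta !linear_sum big1 // => i _.
rewrite linear_sum big1 // => j _.
by rewrite linearZ -deriveE // DF0; exact: mulr0.
Qed.

(** Difference quotients see only increments, so parts of a function that stay constant along the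
    line through [x] drop out before any limit is taken. *)
Lemma eq_derive_increment (R : realType) (V W : normedModType R) (f g : V -> W)
    (x v : V) :
  (forall h : R, f (h *: v + x) - f x = g (h *: v + x) - g x) ->
  'D_v f x = 'D_v g x.
Proof.
move=> fg; rewrite /derive.
rewrite (_ : (fun h => h^-1 *: ((f \o shift x) (h *: v) - f x)) =
             fun h => h^-1 *: ((g \o shift x) (h *: v) - g x)) //.
by apply: funext => h /=; rewrite fg.
Qed.

Section CoreDerivatives.
Context {R : realType} {d r N : nat}.
Implicit Types (ft : multi_index d N -> R) (Q : cores R d r N).

Lemma differentiable_sum_sqr_discrepancy ft (P : pred (multi_index d N)) Q :
  differentiable
    (fun Q' : cores R d r N => \sum_(I | P I) discrepancy ft Q' I ^+ 2) Q.
Proof.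
apply: differentiable_fsum => I _.
apply: (@differentiableX _ _ (fun Q' => discrepancy ft Q' I) 1).
apply: differentiableB; last exact: differentiable_cst.
apply: differentiable_fsum => a _; apply: differentiable_fprod => s _.
exact: differentiable_coord.
Qed.

Lemma differentiable_global_discrepancy ft Q :
  differentiable (global_discrepancy ft : cores R d r N -> R) Q.
Proof. exact/differentiableZ/differentiable_sum_sqr_discrepancy. Qed.

Lemma differentiable_local_discrepancy ft c i Q :
  differentiable (local_discrepancy ft c i : cores R d r N -> R) Q.
Proof. exact/differentiableZ/differentiable_sum_sqr_discrepancy. Qed.

Lemma discrepancy_off_hyperplane ft Q (h : R) c a i (I : multi_index d N) :
  I c != i ->
  discrepancy ft (h *: delta_mx c (mxvec_index a i) + Q) I = discrepancy ft Q I.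
Proof.
move=> Ici; congr (_ - _); apply: eq_bigr => b _; apply: eq_bigr => s _.
rewrite /core_entry !mxE; case: eqP => [->|_] /=; last by rewrite mulr0 add0r.
(* In row [c], the flattening of index pairs is injective: the factor read at [I c] is the perturbed
   entry only if [I c = i], which is excluded. *)
case: eqP => [/cast_ord_inj/enum_rank_inj [_ Ici']|_].
  by rewrite Ici' eqxx in Ici.
by rewrite mulr0 add0r.
Qed.

Lemma global_discrepancy_increment ft Q (h : R) c a i :
  (0 < d)%N ->
  let Q' := h *: delta_mx c (mxvec_index a i) + Q in
  global_discrepancy ft Q' - global_discrepancy ft Q =
  N%:R^-1 * (local_discrepancy ft c i Q' - local_discrepancy ft c i Q).
Proof.
move=> d_gt0 /=; rewrite /local_discrepancy /global_discrepancy -!mulrBr.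
(* The normalizing constants match because [N * N ^ d.-1 = N ^ d], where [0 < d] rules out the
   truncated predecessor. *)
rewrite mulrA -invfM (mulrCA N%:R) -exprS prednK //; congr (_ * _).
rewrite (bigID (fun I : multi_index d N => I c == i)) /=.
rewrite [in X in _ - X](bigID (fun I : multi_index d N => I c == i)) /=.
(* The terms off the hyperplane are the same at both points and cancel. *)
under [X in _ + X - _]eq_bigr do rewrite discrepancy_off_hyperplane //.
by rewrite opprD addrACA subrr addr0.
Qed.

Lemma core_partial_global ft Q c a i : (0 < d)%N ->
  core_partial (global_discrepancy ft) c a i Q =
  N%:R^-1 * core_partial (local_discrepancy ft c i) c a i Q.
Proof.
move=> d_gt0; rewrite /core_partial; set v := delta_mx _ _.
have dL : derivable (local_discrepancy ft c i) Q v.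
  exact/diff_derivable/differentiable_local_discrepancy.
(* The factor [N%:R^-1] moves inside the derivative, so that both sides are derivatives of functions
   with equal increments. *)
rewrite -[RHS](deriveZ N%:R^-1 dL); apply: eq_derive_increment => h.
by rewrite global_discrepancy_increment // mulrBr.
Qed.

End CoreDerivatives.

Theorem theorem1 (R : realType) (d N r : nat)
    (d_ge1 : (1 <= d)%N) (N_ge1 : (1 <= N)%N) (r_ge1 : (1 <= r)%N)
    (ft : multi_index d N -> R) (Q : cores R d r N)
    (local_stationary : forall (c : 'I_d) (i : 'I_N) (a : 'I_r),
       core_partial (local_discrepancy ft c i) c a i Q = 0) :
  stationary_point (global_discrepancy ft) Q.
Proof.
have dF := differentiable_global_discrepancy ft Q.
split=> //; apply: diff_matrix_eq0 => // c j.
(* Every column of the flattened space is some [mxvec_index a i], so the core entries exhaust the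
   coordinates. *)
case/mxvec_indexP: j => a i.
by have := core_partial_global ft Q c a i d_ge1; rewrite local_stationary mulr0.
Qed.
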